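(* Let $\mathcal{C}$ be a category with finite coproducts $(0,+)$ and a symmetric monoidal structure $(I,\otimes)$ such that $\otimes$ distributes over coproducts. Call a map $s\colon I\to I+I$ with $\nabla\circ s=\mathrm{id}_I$ a probability, and for probabilities $s,t$ define $s\cdot t=[s,\kappa_2]\circ t\colon I\to I+I$. Then for all probabilities $s,t$ we have $s\cdot t=t\cdot s$.
   Context: Notation: $\kappa_1,\kappa_2$ are the coprojections, $[f,g]$ is the cotuple, and $\nabla=[\mathrm{id},\mathrm{id}]$. Distributivity means that the canonical maps $[\kappa_1\otimes\mathrm{id},\kappa_2\otimes\mathrm{id}]\colon (X\otimes Z)+(Y\otimes Z)\to(X+Y)\otimes Z$ and $0\to 0\otimes Z$ are isomorphisms. (In a dagger setting, the positive probabilities, i.e. the positive predicates on $I$, form a subset of the probabilities, with the same multiplication.) *)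

(* Defs.v *)
Set Implicit Arguments.
Unset Strict Implicit.
Unset Printing Implicit Defensive.

Declare Scope cat_scope.
Delimit Scope cat_scope with cat.

Record Category := {
  Obj :> Type;
  Hom : Obj -> Obj -> Type;
  id : forall X, Hom X X;
  comp : forall X Y Z, Hom Y Z -> Hom X Y -> Hom X Z;
  comp_idl : forall X Y (f : Hom X Y), comp (id Y) f = f;
  comp_idr : forall X Y (f : Hom X Y), comp f (id X) = f;
  comp_assoc : forall W X Y Z (h : Hom Y Z) (g : Hom X Y) (f : Hom W X),
    comp h (comp g f) = comp (comp h g) f
}.

Arguments Hom {c} X%_cat Y%_cat : rename.
Arguments id {c} X%_cat : rename.
Arguments comp {c X Y Z} g%_cat f%_cat : rename.

Notation "g ∘ f" := (comp g f) (at level 40, left associativity) : cat_scope.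
Open Scope cat_scope.

Definition is_iso (C : Category) (X Y : C) (f : Hom X Y) : Prop :=
  exists g : Hom Y X, g ∘ f = id X /\ f ∘ g = id Y.

Class FiniteCoproducts (C : Category) := {
  initial : C;
  from_initial : forall X, Hom initial X;
  from_initial_unique : forall X (f : Hom initial X), f = from_initial X;
  coprod : C -> C -> C;
  inj1 : forall X Y, Hom X (coprod X Y);
  inj2 : forall X Y, Hom Y (coprod X Y);
  cotuple : forall X Y Z, Hom X Z -> Hom Y Z -> Hom (coprod X Y) Z;
  cotuple_inj1 : forall X Y Z (f : Hom X Z) (g : Hom Y Z),
    cotuple f g ∘ inj1 X Y = f;
  cotuple_inj2 : forall X Y Z (f : Hom X Z) (g : Hom Y Z),
    cotuple f g ∘ inj2 X Y = g;
  cotuple_unique : forall X Y Z (f : Hom X Z) (g : Hom Y Z)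
      (h : Hom (coprod X Y) Z),
    h ∘ inj1 X Y = f -> h ∘ inj2 X Y = g -> h = cotuple f g
}.

Notation "X + Y" := (coprod X Y) : cat_scope.

Definition codiag (C : Category) (P : FiniteCoproducts C) (X : C)
  : Hom (X + X) X := cotuple (id X) (id X).

Class Monoidal (C : Category) := {
  tunit : C;
  tensor : C -> C -> C;
  tensor_map : forall X X' Y Y',
    Hom X X' -> Hom Y Y' -> Hom (tensor X Y) (tensor X' Y');
  tensor_id : forall X Y, tensor_map (id X) (id Y) = id (tensor X Y);
  tensor_comp : forall X X' X'' Y Y' Y''
      (f' : Hom X' X'') (f : Hom X X') (g' : Hom Y' Y'') (g : Hom Y Y'),
    tensor_map (f' ∘ f) (g' ∘ g) = tensor_map f' g' ∘ tensor_map f g;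

  associator : forall X Y Z,
    Hom (tensor (tensor X Y) Z) (tensor X (tensor Y Z));
  associator_iso : forall X Y Z, is_iso (associator X Y Z);
  associator_natural : forall X X' Y Y' Z Z'
      (f : Hom X X') (g : Hom Y Y') (h : Hom Z Z'),
    associator X' Y' Z' ∘ tensor_map (tensor_map f g) h
    = tensor_map f (tensor_map g h) ∘ associator X Y Z;

  left_unitor : forall X, Hom (tensor tunit X) X;
  left_unitor_iso : forall X, is_iso (left_unitor X);
  left_unitor_natural : forall X X' (f : Hom X X'),
    left_unitor X' ∘ tensor_map (id tunit) f = f ∘ left_unitor X;

  right_unitor : forall X, Hom (tensor X tunit) X;
  right_unitor_iso : forall X, is_iso (right_unitor X);
  right_unitor_natural : forall X X' (f : Hom X X'),
    right_unitor X' ∘ tensor_map f (id tunit) = f ∘ right_unitor X;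

  pentagon : forall W X Y Z,
    associator W X (tensor Y Z) ∘ associator (tensor W X) Y Z
    = tensor_map (id W) (associator X Y Z)
      ∘ associator W (tensor X Y) Z
      ∘ tensor_map (associator W X Y) (id Z);
  triangle : forall X Y,
    tensor_map (id X) (left_unitor Y) ∘ associator X tunit Y
    = tensor_map (right_unitor X) (id Y)
}.

Notation "X ⊗ Y" := (tensor X Y) (at level 40, left associativity) : cat_scope.
Notation "f ⊗₁ g" := (tensor_map f g)
  (at level 40, left associativity) : cat_scope.

Class Symmetry (C : Category) (M : Monoidal C) := {
  braiding : forall X Y : C, Hom (X ⊗ Y) (Y ⊗ X);
  braiding_natural : forall X X' Y Y' (f : Hom X X') (g : Hom Y Y'),
    braiding X' Y' ∘ (f ⊗₁ g) = (g ⊗₁ f) ∘ braiding X Y;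
  braiding_invol : forall X Y, braiding Y X ∘ braiding X Y = id (X ⊗ Y);
  hexagon : forall X Y Z,
    associator Y Z X ∘ braiding X (Y ⊗ Z) ∘ associator X Y Z
    = (id Y ⊗₁ braiding X Z) ∘ associator Y X Z ∘ (braiding X Y ⊗₁ id Z)
}.

Definition distributive (C : Category) (P : FiniteCoproducts C)
    (M : Monoidal C) : Prop :=
  (forall X Y Z : C,
     is_iso (cotuple (inj1 X Y ⊗₁ id Z) (inj2 X Y ⊗₁ id Z)
             : Hom ((X ⊗ Z) + (Y ⊗ Z)) ((X + Y) ⊗ Z))) /\
  (forall Z : C, is_iso (from_initial (initial ⊗ Z))).

Definition is_probability (C : Category) (P : FiniteCoproducts C)
    (M : Monoidal C) (s : Hom tunit (tunit + tunit)) : Prop :=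
  codiag P tunit ∘ s = id tunit.

Definition prob_mul (C : Category) (P : FiniteCoproducts C) (M : Monoidal C)
    (s t : Hom tunit (tunit + tunit)) : Hom tunit (tunit + tunit) :=
  cotuple s (inj2 tunit tunit) ∘ t.

(* Main.v *)
(** A map [r : I -> I + I] acts naturally on every object [X], by
    [X ≅ I ⊗ X -> (I + I) ⊗ X ≅ I ⊗ X + I ⊗ X ≅ X + X], and every
    [s : I -> I + I] is the component at [I] of such an action [y].
    Naturality with respect to [t] gives [y ∘ t = (t + t) ∘ s], while naturality
    with respect to the coprojections [κi] of [I + I] gives
    [y = [(κ1 + κ1) ∘ s, (κ2 + κ2) ∘ s]].  Postcomposing with
    [[id, [κ2, κ2]] : (I + I) + (I + I) -> I + I] turns the two sides of the
    first equation into [s · t] and [t · s]. *)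
Require Import Defs.

Set Implicit Arguments.
Unset Strict Implicit.

Lemma iso_mono (C : Category) (X Y Z : C) (f : Hom X Y) (g h : Hom Z X) :
  is_iso f -> f ∘ g = f ∘ h -> g = h.
Proof.
  intros [k [Hk _]] E.
  rewrite <- (comp_idl g), <- (comp_idl h), <- Hk, <- !comp_assoc, E.
  reflexivity.
Qed.

Lemma iso_epi (C : Category) (X Y Z : C) (f : Hom X Y) (g h : Hom Y Z) :
  is_iso f -> g ∘ f = h ∘ f -> g = h.
Proof.
  intros [k [_ Hk]] E.
  rewrite <- (comp_idr g), <- (comp_idr h), <- Hk, !comp_assoc, E.
  reflexivity.
Qed.

Definition coprod_map (C : Category) (P : FiniteCoproducts C) (X X' Y Y' : C)
    (f : Hom X X') (g : Hom Y Y') : Hom (X + Y) (X' + Y') :=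
  cotuple (inj1 X' Y' ∘ f) (inj2 X' Y' ∘ g).

Lemma comp_cotuple (C : Category) (P : FiniteCoproducts C) (X Y Z W : C)
    (h : Hom Z W) (f : Hom X Z) (g : Hom Y Z) :
  h ∘ cotuple f g = cotuple (h ∘ f) (h ∘ g).
Proof.
  apply cotuple_unique; rewrite <- comp_assoc.
  - now rewrite cotuple_inj1.
  - now rewrite cotuple_inj2.
Qed.

Lemma cotuple_coprod_map (C : Category) (P : FiniteCoproducts C)
    (X X' Y Y' Z : C) (h : Hom X' Z) (k : Hom Y' Z)
    (f : Hom X X') (g : Hom Y Y') :
  cotuple h k ∘ coprod_map P f g = cotuple (h ∘ f) (k ∘ g).
Proof.
  unfold coprod_map.
  now rewrite comp_cotuple, !comp_assoc, cotuple_inj1, cotuple_inj2.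
Qed.

Lemma coprod_map_comp (C : Category) (P : FiniteCoproducts C)
    (X X' X'' Y Y' Y'' : C) (f' : Hom X' X'') (f : Hom X X')
    (g' : Hom Y' Y'') (g : Hom Y Y') :
  coprod_map P f' g' ∘ coprod_map P f g = coprod_map P (f' ∘ f) (g' ∘ g).
Proof.
  unfold coprod_map at 1.
  now rewrite cotuple_coprod_map, <- !comp_assoc.
Qed.

Lemma cotuple_inj (C : Category) (P : FiniteCoproducts C) (X Y : C) :
  cotuple (inj1 X Y) (inj2 X Y) = id (X + Y).
Proof. symmetry; apply cotuple_unique; apply comp_idl. Qed.

Lemma coprod_map_id (C : Category) (P : FiniteCoproducts C) (X Y : C) :
  coprod_map P (id X) (id Y) = id (X + Y).
Proof. unfold coprod_map; now rewrite !comp_idr, cotuple_inj. Qed.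

(** This is how the probability condition gets used: if [codiag P tunit ∘ s = id tunit], then
    [cotuple f f ∘ s = f]. *)
Lemma cotuple_diag (C : Category) (P : FiniteCoproducts C) (X Y : C)
    (f : Hom X Y) :
  cotuple f f = f ∘ codiag P X.
Proof. unfold codiag; now rewrite comp_cotuple, comp_idr. Qed.

Definition distributor (C : Category) (P : FiniteCoproducts C)
    (M : Monoidal C) (X Y Z : C) : Hom ((X ⊗ Z) + (Y ⊗ Z)) ((X + Y) ⊗ Z) :=
  cotuple (inj1 X Y ⊗₁ id Z) (inj2 X Y ⊗₁ id Z).

Lemma tensor_interchange (C : Category) (M : Monoidal C) (X X' Y Y' : C)
    (f : Hom X X') (g : Hom Y Y') :
  (id X' ⊗₁ g) ∘ (f ⊗₁ id Y) = (f ⊗₁ id Y') ∘ (id X ⊗₁ g).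
Proof. now rewrite <- !tensor_comp, !comp_idl, !comp_idr. Qed.

Lemma distributor_natural (C : Category) (P : FiniteCoproducts C)
    (M : Monoidal C) (X Y Z Z' : C) (f : Hom Z Z') :
  distributor P M X Y Z' ∘ coprod_map P (id X ⊗₁ f) (id Y ⊗₁ f)
  = (id (X + Y) ⊗₁ f) ∘ distributor P M X Y Z.
Proof.
  unfold distributor.
  now rewrite cotuple_coprod_map, comp_cotuple, !tensor_interchange.
Qed.

(* [x] is the component at [X] of the action of [r]. The witness [z] stands for
   the composite of [r ⊗ id] with the inverse of the distributor; isomorphisms
   are only known to be invertible propositionally, so no inverse is named. *)
Definition acts_as (C : Category) (P : FiniteCoproducts C) (M : Monoidal C)
    (r : Hom (c := C) tunit (tunit + tunit)) (X : C) (x : Hom X (X + X))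
    : Prop :=
  exists z : Hom (tunit ⊗ X) ((tunit ⊗ X) + (tunit ⊗ X)),
    distributor P M tunit tunit X ∘ z = r ⊗₁ id X /\
    coprod_map P (left_unitor X) (left_unitor X) ∘ z = x ∘ left_unitor X.

Lemma acts_as_exists (C : Category) (P : FiniteCoproducts C) (M : Monoidal C)
    (HD : distributive P M) (r : Hom (c := C) tunit (tunit + tunit)) (X : C) :
  exists x : Hom X (X + X), acts_as r x.
Proof.
  destruct (proj1 HD tunit tunit X) as [d [_ Hd]].
  destruct (left_unitor_iso X) as [l [Hl _]].
  exists (coprod_map P (left_unitor X) (left_unitor X) ∘ (d ∘ (r ⊗₁ id X)) ∘ l).
  exists (d ∘ (r ⊗₁ id X)); split.
  - rewrite comp_assoc; unfold distributor; now rewrite Hd, comp_idl.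
  - now rewrite <- (comp_assoc _ l), Hl, comp_idr.
Qed.

(** Each constituent of the action is natural, and the isomorphisms on either side cancel. With [f]
    an identity, this also shows that [r] determines its component at each object. *)
Lemma acts_as_natural (C : Category) (P : FiniteCoproducts C) (M : Monoidal C)
    (HD : distributive P M) (r : Hom (c := C) tunit (tunit + tunit)) (X Y : C)
    (f : Hom X Y) (x : Hom X (X + X)) (y : Hom Y (Y + Y)) :
  acts_as r x -> acts_as r y -> y ∘ f = coprod_map P f f ∘ x.
Proof.
  intros [z [Dz Lz]] [w [Dw Lw]].
  (* Naturality is first shown for the witnesses, after composing with the monic distributor, where
     both sides become [r ⊗₁ f]. *)
  assert (E : w ∘ (id tunit ⊗₁ f)
              = coprod_map P (id tunit ⊗₁ f) (id tunit ⊗₁ f) ∘ z).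
  { apply (iso_mono (f := distributor P M tunit tunit Y)); [apply HD|].
    now rewrite !comp_assoc, distributor_natural, Dw, <- comp_assoc, Dz,
      tensor_interchange. }
  apply (iso_epi (left_unitor_iso X)).
  rewrite <- !comp_assoc, <- left_unitor_natural, <- Lz.
  rewrite (comp_assoc y), <- Lw, <- (comp_assoc _ w), E, !comp_assoc,
    !coprod_map_comp.
  now rewrite left_unitor_natural.
Qed.

(* [r] is found by fullness of [- ⊗ I], which avoids proving that the left and
   right unitors agree at [I]. *)
Lemma acts_as_unit (C : Category) (P : FiniteCoproducts C) (M : Monoidal C)
    (s : Hom (c := C) tunit (tunit + tunit)) :
  exists r, acts_as r s.
Proof.
  destruct (left_unitor_iso tunit) as [l [_ Hl]].
  destruct (right_unitor_iso tunit) as [k [Hk _]].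
  (* The second condition of [acts_as] forces this [z]; the first then says what [r ⊗₁ id tunit]
     must be. *)
  set (z := coprod_map P l l ∘ s ∘ left_unitor tunit).
  exists (right_unitor (tunit + tunit) ∘ (distributor P M tunit tunit tunit ∘ z)
          ∘ k).
  exists z; split.
  - apply (iso_mono (right_unitor_iso _)).
    now rewrite right_unitor_natural, <- (comp_assoc _ k), Hk, comp_idr.
  - unfold z.
    now rewrite !comp_assoc, coprod_map_comp, Hl, coprod_map_id, comp_idl.
Qed.

Theorem theorem8p4 (C : Category) (P : FiniteCoproducts C) (M : Monoidal C)
    (S : Symmetry M) (HD : distributive P M)
    (s t : Hom (c := C) tunit (tunit + tunit)) :
  is_probability s -> is_probability t -> prob_mul s t = prob_mul t s.
Proof.
  unfold is_probability, prob_mul; intros Hs Ht.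
  destruct (acts_as_unit s) as [r Hr].
  destruct (acts_as_exists HD r (tunit + tunit)) as [y Hy].
  set (k1 := inj1 tunit tunit); set (k2 := inj2 tunit tunit).
  set (a := cotuple (id (tunit + tunit)) (cotuple k2 k2)).
  (* On the two summands, [a ∘ y] is [cotuple k1 k2 ∘ s], which is [s], and [cotuple k2 k2 ∘ s],
     which is [k2] because [s] is a probability. *)
  assert (Ea : a ∘ y = cotuple s k2).
  { apply cotuple_unique; rewrite <- comp_assoc, (acts_as_natural HD _ Hr Hy),
      comp_assoc; unfold a; rewrite cotuple_coprod_map, comp_idl.
    - now rewrite cotuple_inj1, cotuple_inj, comp_idl.
    - now rewrite cotuple_inj2, cotuple_diag, <- comp_assoc, Hs, comp_idr. }
  (* Naturality at [t] moves [t] past the action, leaving [cotuple t (cotuple k2 k2 ∘ t) ∘ s]; the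
     inner composite is [k2] because [t] is a probability. *)
  rewrite <- Ea, <- comp_assoc, (acts_as_natural HD t Hr Hy), comp_assoc.
  unfold a; rewrite cotuple_coprod_map, comp_idl.
  now rewrite cotuple_diag, <- (comp_assoc k2), Ht, comp_idr.
Qed.
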